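(* Let $V$ and $H$ be Hilbert spaces, let $\mathfrak{a}\colon V\times V\to\mathbb{C}$ be a continuous accretive sesquilinear form and let $j\in\mathcal{L}(V,H)$ have dense range. Suppose $(\mathfrak{a},j)$ is associated with an m-accretive operator $A$. Let $\theta\in[0,\tfrac{\pi}{2})$. Let $(B_n)_{n\in\mathbb{N}}$ be a sequence of bounded sectorial operators in $V$ with vertex $0$ and semi-angle $\theta$. Moreover, suppose there exist sequences of strictly positive numbers $(\delta_n)$ and $(\varepsilon_n)$ such that $\lim_{n\to\infty}\varepsilon_n^2/\delta_n=0$ and \[ \delta_n\|u\|_V^2\le\operatorname{Re}(B_nu\mid u)_V\le\varepsilon_n\|u\|_V^2 \] for all $u\in V$ and $n\in\mathbb{N}$. For every $n\in\mathbb{N}$ define $\mathfrak{a}_n\colon V\times V\to\mathbb{C}$ by \[ \mathfrak{a}_n(u,v)=\mathfrak{a}(u,v)+(B_nu\mid v)_V . \] Then $\mathfrak{a}_n$ is $j$-elliptic and continuous, and $(\mathfrak{a}_n,j)$ is associated with an m-sectorial operator $A_n$ for all $n\in\mathbb{N}$. Moreover, $A_n\to A$ in norm resolvent sense.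
   Context: Hilbert spaces are complex; inner products and sesquilinear forms are linear in the first and antilinear in the second argument. $\mathcal{L}(V,H)$ denotes the bounded linear operators from $V$ to $H$. The map $j$ is not assumed to be injective. A form $\mathfrak{a}$ on $V$ is accretive if $\operatorname{Re}\mathfrak{a}(u,u)\ge 0$ for all $u\in V$. It is $j$-elliptic if there are $\omega\in\mathbb{R}$ and $\mu>0$ such that $\operatorname{Re}\mathfrak{a}(u,u)+\omega\|j(u)\|_H^2\ge\mu\|u\|_V^2$ for all $u\in V$. An operator in $H$ is a linear map $A\colon D(A)\to H$ on a linear subspace $D(A)\subset H$. It is accretive if $\operatorname{Re}(Ax\mid x)\ge 0$ for all $x\in D(A)$, and m-accretive if in addition $I+A$ is surjective. An operator $B$ is sectorial with vertex $\gamma\in\mathbb{R}$ and semi-angle $\theta\in[0,\frac{\pi}{2})$ if $|\operatorname{Im}((B-\gamma)x\mid x)|\le\tan\theta\,\operatorname{Re}((B-\gamma)x\mid x)$ for all $x\in D(B)$; it is m-sectorial if it is sectorial with some vertex $\gamma$ and some semi-angle in $[0,\frac{\pi}{2})$, and $B-\gamma I$ is m-accretive. Define $D_j(\mathfrak{a})=\{u\in V : \text{there exists } f\in H \text{ such that } \mathfrak{a}(u,v)=(f\mid j(v))_H \text{ for all } v\in V\}$. The pair $(\mathfrak{a},j)$ is associated with the operator $A$ in $H$ if $D(A)=j(D_j(\mathfrak{a}))$ and $\mathfrak{a}(u,v)=(Aj(u)\mid j(v))_H$ for all $u\in D_j(\mathfrak{a})$ and $v\in V$; such an $A$ is unique if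 it exists. The same definition is used for $(\mathfrak{a}_n,j)$. $A_n\to A$ in norm resolvent sense means that $(\lambda I+A_n)^{-1}\to(\lambda I+A)^{-1}$ in operator norm on $H$ for $\lambda>0$ (equivalently, for $\lambda=1$). *)

(* Defs.v *)
From HB Require Import structures.
From mathcomp Require Import all_boot all_order all_algebra.
From mathcomp Require Import all_classical all_reals all_analysis.
From mathcomp Require Export complex.
Export numFieldNormedType.Exports.

Set Implicit Arguments.
Unset Strict Implicit.
Unset Printing Implicit Defensive.

Import Order.TTheory GRing.Theory Num.Theory.

Local Open Scope classical_set_scope.
Local Open Scope ring_scope.
Local Open Scope complex_scope.

(* A real number r is compared with complex numbers through r%:C; on R[i] the
   order x <= y means that x and y have the same imaginary part and that
   Re x <= Re y. In particular the norms `|u| below live in R[i]. *)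

(* Complex Hilbert spaces. The library's {dot V for theta} is linear in the
   first argument, theta-linear in the second one, hermitian and positive
   definite. *)
HB.mixin Record isHilbert (R : realType) V & CompleteNormedModule R[i] V := {
  inner : {dot V for (@Num.conj R[i])};
  inner_norm : forall u : V, inner u u = `|u| ^+ 2
}.

#[short(type="hilbertType")]
HB.structure Definition Hilbert (R : realType) :=
  {V of isHilbert R V & CompleteNormedModule R[i] V}.

Local Notation "''[' u , v ]" := (inner u v) : ring_scope.

Section Forms.
Variables (R : realType) (V H : hilbertType R).

Definition sesquilinear_form :=
  {bilinear V -> V -> R[i] | *%R & @Num.conj R[i] \; *%R}.

Implicit Types (a : sesquilinear_form) (j : {linear V -> H}).

Definition continuous_form a := continuous (fun p : V * V => a p.1 p.2 : R[i]^o).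

Definition accretive_form a := forall u, 0 <= 'Re (a u u).

Definition j_elliptic j a := exists omega mu : R, 0 < mu /\
  forall u, mu%:C * `|u| ^+ 2 <= 'Re (a u u) + omega%:C * `|j u| ^+ 2.

Definition perturbed_fun a (B : {linear V -> V}) (u v : V) : R[i] :=
  a u v + '[B u, v].

Lemma perturbed_fun_bilinear a (B : {linear V -> V}) :
  @bilinear_for R[i] V V R[i] *%R (@Num.conj R[i] \; *%R) (perturbed_fun a B).
Proof.
have E (c p q r s : R[i]) : c * p + q + (c * r + s) = c * (p + r) + (q + s).
  by rewrite mulrDr addrACA.
by split=> [v|u] c x y; rewrite /perturbed_fun;
  [rewrite linearPl linearP linearPl | rewrite !linearPr]; exact: E.
Qed.

HB.instance Definition _ a (B : {linear V -> V}) :=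
  bilinear_isBilinear.Build R[i] V V R[i] *%R (@Num.conj R[i] \; *%R)
    (perturbed_fun a B) (perturbed_fun_bilinear a B).

Definition perturbed_form a (B : {linear V -> V}) : sesquilinear_form :=
  perturbed_fun a B.

End Forms.

(* op_fun is only meaningful on op_dom. *)
Record operator (R : realType) (H : hilbertType R) := Operator {
  op_dom : set H;
  op_fun :> H -> H;
  op_dom0 : op_dom 0;
  op_domP : forall (c : R[i]) x y,
    op_dom x -> op_dom y -> op_dom (c *: x + y);
  op_linear : forall (c : R[i]) x y,
    op_dom x -> op_dom y -> op_fun (c *: x + y) = c *: op_fun x + op_fun y
}.

Section Operators.
Variables (R : realType) (H : hilbertType R).
Implicit Types (A : operator H) (T : {linear H -> H}).

Program Definition total_operator T : operator H :=
  @Operator R H setT T _ _ _.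
Next Obligation. by []. Qed.
Next Obligation. by []. Qed.
Next Obligation. by move=> T c x y _ _; rewrite linearP. Qed.

(* A + t I, with the domain of A. *)
Program Definition op_shift A (t : R) : operator H :=
  @Operator R H (op_dom A) (fun x => A x + t%:C *: x) (op_dom0 A) _ _.
Next Obligation. by move=> A t c x y; exact: op_domP. Qed.
Next Obligation.
move=> A t c x y Dx Dy /=; rewrite (op_linear c Dx Dy) !scalerDr !scalerA.
by rewrite (mulrC t%:C) !addrA; congr (_ + _); rewrite addrAC.
Qed.

Definition accretive A := forall x, op_dom A x -> 0 <= 'Re '[A x, x].

Definition m_accretive A := accretive A /\
  forall y, exists2 x, op_dom A x & op_shift A 1 x = y.

Definition sectorial A (gamma theta : R) := forall x, op_dom A x ->
  `|'Im '[op_shift A (- gamma) x, x]|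
    <= (tan theta)%:C * 'Re '[op_shift A (- gamma) x, x].

Definition m_sectorial A := exists gamma theta : R,
  [/\ 0 <= theta < pi / 2, sectorial A gamma theta &
      m_accretive (op_shift A (- gamma))].

Definition bounded_inverse A T := [/\ continuous T,
  forall y, op_dom A (T y) /\ A (T y) = y &
  forall x, op_dom A x -> T (A x) = x].

(* The operator norm of a bounded T; [sup] is 0 by convention on sets that are
   not bounded above, so this is only used for differences of continuous
   linear maps. *)
Definition opnorm (T : H -> H) : R :=
  sup [set complex.Re `|T x| | x in [set x : H | `|x| <= 1]].

Definition norm_resolvent_cvg (A_ : nat -> operator H) A :=
  forall lambda : R, 0 < lambda ->
  exists (S_ : nat -> {linear H -> H}) (S : {linear H -> H}),
    [/\ forall n, bounded_inverse (op_shift (A_ n) lambda) (S_ n),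
        bounded_inverse (op_shift A lambda) S &
        opnorm (fun x => S_ n x - S x) @[n --> \oo] --> (0 : R)].

End Operators.

Section Association.
Variables (R : realType) (V H : hilbertType R).
Implicit Types (a : sesquilinear_form V) (j : {linear V -> H}).

Definition form_dom a j : set V :=
  [set u | exists f : H, forall v, a u v = '[f, j v]].

Definition associated a j (A : operator H) :=
  op_dom A = j @` form_dom a j /\
  forall u, form_dom a j u -> forall v, a u v = '[A (j u), j v].

End Association.

(* Main.v *)
(* If u_n solves the form equation of lambda + A_n with datum f, and u that of
   lambda + A, subtracting and testing with u_n - u gives
     lambda |j u_n - j u|^2 + Re (B_n u_n | u_n) <= Re (B_n u_n | u).
   Polarization bounds the right-hand side by C eps_n |u_n| |u|, and Young's
   inequality absorbs u_n into the coercivity constant delta_n, so that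
     lambda |j u_n - j u|^2 <= C^2 eps_n^2 / (4 delta_n) |u|^2.
   There is no linear bound on u in terms of f at hand, but for each fixed f
   this shows that the difference of the resolvents applied to f is at most
   |u| times a null sequence s_n; the uniform boundedness principle for the
   differences divided by s_n then gives convergence in operator norm. *)

From HB Require Import structures.
Require Import Defs.
From mathcomp Require Import all_boot all_order all_algebra.
From mathcomp Require Import all_classical all_reals all_analysis.
From mathcomp Require Import ring lra.
Import Order.TTheory GRing.Theory Num.Theory.
Local Open Scope classical_set_scope.
Local Open Scope ring_scope.
Local Open Scope complex_scope.
Set Implicit Arguments.
Unset Strict Implicit.
Unset Printing Implicit Defensive.

(** * Real-valued norms and real parts of inner products *)

Section RealHilbert.
Context {R : realType}.

Lemma ReD (x y : R[i]) : complex.Re (x + y) = complex.Re x + complex.Re y.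
Proof. by case: x => a b; case: y. Qed.

Lemma ReB (x y : R[i]) : complex.Re (x - y) = complex.Re x - complex.Re y.
Proof. by case: x => a b; case: y. Qed.

Lemma ReZ (t : R) (x : R[i]) : complex.Re (t%:C * x) = t * complex.Re x.
Proof. by case: x => a b /=; rewrite mul0r subr0. Qed.

Lemma ReJ (x : R[i]) : complex.Re (Num.conj x) = complex.Re x.
Proof. by case: x. Qed.

Lemma conj_real (t : R) : Num.conj t%:C = t%:C.
Proof. exact: conjc_real. Qed.

Lemma norm_real_complex (t : R) : `|t%:C| = `|t|%:C.
Proof. by rewrite normc_def /= expr0n /= addr0 sqrtr_sqr. Qed.

Context {V : hilbertType R}.
Implicit Types (u v w : V) (s t : R).

(** Norms take values in [R[i]]; this real copy, with [rinner], opens the estimates to the ordered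
    field [R], hence to [lra] and to real suprema. *)
Definition rnorm u : R := complex.Re `|u|.

Definition rinner u v : R := complex.Re (inner u v).

Lemma rnormE u : `|u| = (rnorm u)%:C.
Proof. by rewrite /rnorm RRe_real// ger0_real. Qed.

Lemma rnorm_ge0 u : 0 <= rnorm u.
Proof. by rewrite -ler0c -rnormE. Qed.

Lemma rnorm0 : rnorm 0 = 0.
Proof. by rewrite /rnorm normr0. Qed.

Lemma rnorm0_eq0 u : rnorm u = 0 -> u = 0.
Proof. by move=> u0; apply/normr0_eq0; rewrite rnormE u0. Qed.

Lemma rnormD u v : rnorm (u + v) <= rnorm u + rnorm v.
Proof. by rewrite -lecR rmorphD/= -!rnormE ler_normD. Qed.

Lemma rnormN u : rnorm (- u) = rnorm u.
Proof. by rewrite /rnorm normrN. Qed.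

Lemma rnormB u v : rnorm (u - v) <= rnorm u + rnorm v.
Proof. by rewrite -(rnormN v) rnormD. Qed.

Lemma rnormC u v : rnorm (u - v) = rnorm (v - u).
Proof. by rewrite -rnormN opprB. Qed.

Lemma rnormZ (c : R[i]) u : rnorm (c *: u) = complex.Re `|c| * rnorm u.
Proof.
by rewrite /rnorm normrZ; case: `|u| => a b; rewrite normc_def /= mul0r subr0.
Qed.

Lemma rnormZr t u : rnorm (t%:C *: u) = `|t| * rnorm u.
Proof. by rewrite rnormZ normc_def /= expr0n /= addr0 sqrtr_sqr. Qed.

Lemma rnorm_sqr u : rnorm u ^+ 2 = rinner u u.
Proof. by rewrite /rinner inner_norm rnormE -rmorphXn. Qed.

Lemma innerC u v : inner u v = Num.conj (inner v u).
Proof. by rewrite hermC expr0 mul1r. Qed.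

Lemma rinnerC u v : rinner u v = rinner v u.
Proof. by rewrite /rinner innerC ReJ. Qed.

Lemma rinnerDl u v w : rinner (u + v) w = rinner u w + rinner v w.
Proof. by rewrite /rinner linearDl ReD. Qed.

Lemma rinnerBl u v w : rinner (u - v) w = rinner u w - rinner v w.
Proof. by rewrite /rinner linearBl ReB. Qed.

Lemma rinnerZl t u w : rinner (t%:C *: u) w = t * rinner u w.
Proof. by rewrite /rinner linearZl_LR/= ReZ. Qed.

Lemma rinnerDr u v w : rinner w (u + v) = rinner w u + rinner w v.
Proof. by rewrite /rinner linearDr ReD. Qed.

Lemma rinnerBr u v w : rinner w (u - v) = rinner w u - rinner w v.
Proof. by rewrite /rinner linearBr ReB. Qed.

Lemma rinnerZr t u w : rinner w (t%:C *: u) = t * rinner w u.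
Proof. by rewrite /rinner linearZr_LR/= conj_real ReZ. Qed.

Lemma sqr_rnormD u v :
  rnorm (u + v) ^+ 2 = rnorm u ^+ 2 + 2 * rinner u v + rnorm v ^+ 2.
Proof. by rewrite !rnorm_sqr rinnerDl !rinnerDr (rinnerC v u); ring. Qed.

Lemma sqr_rnormB u v :
  rnorm (u - v) ^+ 2 = rnorm u ^+ 2 - 2 * rinner u v + rnorm v ^+ 2.
Proof. by rewrite !rnorm_sqr rinnerBl !rinnerBr (rinnerC v u); ring. Qed.

(** The norm already satisfies the triangle inequality; squaring it and expanding leaves exactly
    this. *)
Lemma le_rinner u v : rinner u v <= rnorm u * rnorm v.
Proof.
have := rnormD u v; rewrite -(ler_pXn2r (_ : 0 < 2)%N) ?nnegrE ?addr_ge0 ?rnorm_ge0//.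
rewrite sqr_rnormD; lra.
Qed.

Lemma rinner_CS u v : `|rinner u v| <= rnorm u * rnorm v.
Proof.
rewrite ler_norml le_rinner andbT lerNl.
have := le_rinner (- u) v; rewrite rnormN.
by have := rinnerBl 0 u v; rewrite /rinner !linear0l sub0r sub0r => ->.
Qed.

End RealHilbert.

(** * Completeness, the contraction principle and Riesz representation *)

Lemma hilbert_complete (R : realType) (V : hilbertType R) (x : nat -> V)
    (e : nat -> R) :
  e n @[n --> \oo] --> 0 ->
  (forall n m, (n <= m)%N -> rnorm (x m - x n) <= e n) ->
  exists l, forall n, rnorm (l - x n) <= e n.
Proof.
move=> e0 xe.
have e_small (t : R) : 0 < t -> exists n, forall k, (n <= k)%N -> e k < t.
  move=> t0; have /cvgrPdist_lt /(_ t t0) [n _ H] := e0.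
  exists n => k nk; have := H k nk; rewrite sub0r normrN.
  exact: le_lt_trans (ler_norm _).
have cx : cauchy (x n @[n --> \oo]).
  apply: cauchy_exP => eps eps0.
  have epsE : eps = (complex.Re eps)%:C by rewrite RRe_real// gtr0_real.
  have [n en] : exists n, forall k, (n <= k)%N -> e k < complex.Re eps.
    by apply: e_small; rewrite -ltcR -epsE.
  exists (x n); exists n => // m /= nm.
  rewrite -ball_normE /= epsE rnormE ltcR rnormC.
  exact: le_lt_trans (xe _ _ nm) (en _ (leqnn n)).
have /cauchy_cvgP /cvg_ex [l xl] := cx.
exists l => n; apply/ler_addgt0Pr => t t0.
have /cvgrPdist_lt /(_ t%:C) := xl; rewrite ltcR => /(_ t0) [m _ H].
(* Comparison through the index [maxn n m] costs [e n] plus an arbitrarily small [t], so the limit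
   inherits the rate [e]. *)
have nm : (n <= maxn n m)%N by rewrite leq_maxl.
have /= := H _ (leq_maxr n m); rewrite rnormE ltcR => /ltW H1.
have -> : l - x n = (l - x (maxn n m)) + (x (maxn n m) - x n).
  by rewrite addrA subrK.
apply: le_trans (rnormD _ _) _; rewrite addrC lerD//.
exact: xe.
Qed.

Lemma cvg0_le0 (R : realType) (e : nat -> R) (a : R) :
  e n @[n --> \oo] --> 0 -> (forall n, a <= e n) -> a <= 0.
Proof.
move=> e0 ae; rewrite -(cvg_lim _ e0)//; apply: limr_ge; first by apply/cvg_ex; exists 0.
exact: nearW.
Qed.

Lemma cvg_geometric_mul (R : realType) (c q : R) :
  0 <= q < 1 -> c * q ^+ n @[n --> \oo] --> 0.
Proof.
move=> /andP[q0 q1]; rewrite -[X in _ --> X](mulr0 c).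
by apply: cvgMr; apply: cvg_expr; rewrite ger0_norm.
Qed.

Lemma hilbert_fixed_point (R : realType) (V : hilbertType R) (F : V -> V) (q : R) :
  0 <= q < 1 -> (forall x y, rnorm (F x - F y) <= q * rnorm (x - y)) ->
  exists x, F x = x.
Proof.
move=> q01 Fq; have /andP[q0 q1] := q01.
have q1' : 0 < 1 - q by rewrite subr_gt0.
pose x n := iter n F 0.
(* The sum of the geometric series of step lengths; with it the step bound is D (q^n - q^(n+1)),
   which telescopes. *)
pose D := rnorm (F 0) / (1 - q).
have D0 : 0 <= D by rewrite divr_ge0 ?rnorm_ge0// ltW.
have DE : rnorm (F 0) = D * (1 - q) by rewrite divfK// gt_eqF.
have step n : rnorm (x n.+1 - x n) <= q ^+ n * (D * (1 - q)).
  elim: n => [|n IH]; first by rewrite expr0 mul1r /x /= subr0 DE.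
  apply: le_trans (Fq _ _) _; rewrite exprS -mulrA; exact: ler_wpM2l.
have dist n k : rnorm (x (n + k)%N - x n) <= D * (q ^+ n - q ^+ (n + k)).
  elim: k => [|k IH]; first by rewrite addn0 !subrr rnorm0 mulr0.
  rewrite addnS -(subrK (x (n + k)%N) (x _)) -addrA.
  apply: le_trans (rnormD _ _) _; have := step (n + k)%N; rewrite exprS.
  move: IH; move: (q ^+ (n + k)) (q ^+ n) => a b; lra.
have [l xl] : exists l, forall n, rnorm (l - x n) <= D * q ^+ n.
  apply: hilbert_complete; first exact: cvg_geometric_mul.
  move=> n m /subnKC <-; apply: le_trans (dist _ _) _.
  by rewrite ler_wpM2l// gerBl exprn_ge0.
exists l; apply/subr0_eq/rnorm0_eq0/eqP; rewrite eq_le rnorm_ge0 andbT.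
(* F l - l splits as (F l - F x_n) + (x_(n+1) - l), and each term is at most D q^(n+1). *)
apply: (@cvg0_le0 _ (fun n => (2 * D * q) * q ^+ n)); first exact: cvg_geometric_mul.
move=> n; rewrite -(subrK (x n.+1) (F l)) -addrA.
apply: le_trans (rnormD _ _) _.
have := Fq l (x n); have := xl n.+1; rewrite (rnormC l (x n.+1)) exprS -[F (x n)]/(x n.+1) => h1 h2.
have := ler_wpM2l q0 (xl n); lra.
Qed.

(** The representing vector minimizes |v|^2 - 2 f v: minimizing sequences are Cauchy by the
    parallelogram identity, and the first variation vanishes at the limit. *)
Lemma riesz_real (R : realType) (V : hilbertType R) (f : V -> R) (M : R) :
  (forall (t : R) u v, f (u + t%:C *: v) = f u + t * f v) ->
  (forall v, f v <= M * rnorm v) ->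
  exists z, forall v, f v = rinner z v.
Proof.
move=> fl fM; pose J v := rnorm v ^+ 2 - 2 * f v.
have JE t u v : J (u + t%:C *: v) =
    J u + 2 * t * (rinner u v - f v) + t ^+ 2 * rnorm v ^+ 2.
  by rewrite /J sqr_rnormD fl rinnerZr rnormZr exprMn real_normK ?num_real//; ring.
have Jlb v : - M ^+ 2 <= J v.
  by rewrite /J; have := fM v; have := sqr_ge0 (rnorm v - M); lra.
pose E := range J.
have infE : has_inf E by split; [exists (J 0), 0 | exists (- M ^+ 2) => _ [v _ <-]].
have dJ v : inf E <= J v by apply: ge_inf; [case: infE | exists v].
pose e n : R := 2^-1 ^+ n.
have e0 n : 0 < e n by rewrite exprn_gt0.
(* An excess of e_n^2 over the infimum turns into distances of order e_n. *)
have /choice[x xJ] n : exists v, J v < inf E + e n ^+ 2.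
  have [_ [v _ <-] ?] := inf_adherent (exprn_gt0 2 (e0 n)) infE.
  by exists v.
have half : 0 <= (2^-1 : R) < 1 by lra.
have [z xz] : exists z, forall n, rnorm (z - x n) <= 2 * e n.
  apply: hilbert_complete; first exact: cvg_geometric_mul.
  move=> n m nm; rewrite -(ler_pXn2r (_ : 0 < 2)%N) ?nnegrE ?rnorm_ge0 ?mulr_ge0// ?(ltW (e0 n))//.
  have emn : e m ^+ 2 <= e n ^+ 2.
    rewrite ler_pXn2r ?nnegrE ?(ltW (e0 _))//; apply: ler_wiXn2l => //; lra.
  (* parallelogram identity: [J] at the midpoint is at least [inf E] *)
  have := dJ (x n + (2^-1)%:C *: (x m - x n)); rewrite JE.
  have := JE 1 (x n) (x m - x n); rewrite scale1r addrC subrK.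
  have := xJ n; have := xJ m; rewrite expr1n !mul1r; lra.
exists z => v.
apply/eqP; rewrite -subr_eq0 -normr_le0.
apply: (@cvg0_le0 _ (fun n => (1 + rnorm v ^+ 2 + 2 * rnorm v) * e n)).
  exact: cvg_geometric_mul.
move=> n.
(* Near-minimality along the line through [x n] in direction [v]. Taking t = e_n and t = -e_n gives
   the Euler equation at [x n] up to O(e_n), so no continuity of [J] or [f] is invoked. *)
have hx t : - e n ^+ 2 <= 2 * t * (rinner (x n) v - f v) + t ^+ 2 * rnorm v ^+ 2.
  by have := dJ (x n + t%:C *: v); rewrite JE; have := xJ n; lra.
have bd : `|rinner (x n) v - f v| <= e n * (1 + rnorm v ^+ 2).
  have := hx (e n); have := hx (- e n); have := e0 n.
  set s := rinner _ _ - _; move=> en0 hN hP.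
  have hN' : e n * (2 * s) <= e n * (e n * (1 + rnorm v ^+ 2)) by lra.
  have hP' : e n * (- (2 * s)) <= e n * (e n * (1 + rnorm v ^+ 2)) by lra.
  rewrite !(ler_pM2l en0) in hN' hP'.
  have : 0 <= e n * (1 + rnorm v ^+ 2) by rewrite mulr_ge0 ?(ltW en0)// addr_ge0// sqr_ge0.
  rewrite ler_norml; lra.
have bz : `|rinner (z - x n) v| <= 2 * e n * rnorm v.
  by apply: le_trans (rinner_CS _ _) _; rewrite ler_wpM2r ?rnorm_ge0.
have -> : f v - rinner z v = - (rinner (x n) v - f v) - rinner (z - x n) v.
  by rewrite rinnerBl; ring.
apply: le_trans (ler_normB _ _) _; rewrite normrN; lra.
Qed.

Definition antilinear_functional (R : realType) (V : hilbertType R) (f : V -> R[i]) :=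
  forall (c : R[i]) u v, f (u + c *: v) = f u + Num.conj c * f v.

(** An antilinear functional is determined by its real part, since Im f(v) = Re f(iv); the same
    holds for v -> (z | v). *)
Lemma riesz_representation (R : realType) (V : hilbertType R) (f : V -> R[i]) (M : R) :
  antilinear_functional f -> (forall v, `|f v| <= (M * rnorm v)%:C) ->
  exists z, forall v, f v = inner z v.
Proof.
move=> fl fM.
have [z zf] : exists z, forall v, complex.Re (f v) = rinner z v.
  apply: (@riesz_real _ _ _ M) => [t u v|v].
    by rewrite fl ReD conj_real ReZ.
  rewrite -lecR; apply: le_trans (fM v); apply: le_trans (normc_ge_Re _).
  by rewrite lecR ler_norm.
exists z => v.
have := zf ('i%C *: v); have := zf v; rewrite /rinner linearZr_LR/=.
have := fl 'i%C 0 v; rewrite add0r => ->.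
have -> : f 0 = 0 by have := fl (-1) 0 0; rewrite scaler0 addr0 rmorphN rmorph1 mulN1r subrr.
by case: (f v) (inner z v) => a b [c d] /= -> ; rewrite !mul0r !add0r !mulN1r !opprK => ->.
Qed.

(** * Bounded coercive forms and the Lax-Milgram theorem *)

Definition form_bounded (R : realType) (V : hilbertType R) (b : sesquilinear_form V) (M : R) :=
  forall u v, `|b u v| <= (M * rnorm u * rnorm v)%:C.

(** Riesz turns the form into an operator [T] and the functional into a vector [g]; for small r the
    map u -> u - r (T u - g) is a contraction, and its fixed point solves T u = g. *)
Lemma lax_milgram (R : realType) (V : hilbertType R) (b : sesquilinear_form V)
    (M alpha L : R) (f : V -> R[i]) :
  form_bounded b M -> 0 < alpha ->
  (forall u, alpha * rnorm u ^+ 2 <= complex.Re (b u u)) ->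
  antilinear_functional f -> (forall v, `|f v| <= (L * rnorm v)%:C) ->
  exists u, forall v, b u v = f v.
Proof.
move=> bM a0 ba fl fL.
have [g gE] := riesz_representation fl fL.
have /choice[T TE] u : exists z, forall v, b u v = inner z v.
  apply: (@riesz_representation _ _ _ (M * rnorm u)) => [c v w|]; last exact: bM.
  by rewrite linearDr linearZr_LR.
have TB u w v : inner (T u - T w) v = b (u - w) v.
  by rewrite [RHS]linearBl !TE -linearBl.
have TM u w : rnorm (T u - T w) ^+ 2 <= M ^+ 2 * rnorm (u - w) ^+ 2.
  have := rnorm_sqr (T u - T w); rewrite {1}/rinner TB => E.
  have : rnorm (T u - T w) ^+ 2 <= M * rnorm (u - w) * rnorm (T u - T w).
    rewrite {1}E -lecR; apply: le_trans (bM _ _); apply: le_trans (normc_ge_Re _).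
    by rewrite lecR ler_norm.
  (* Completing the square replaces a division by the norm of T u - T w, which may vanish. *)
  have := sqr_ge0 (rnorm (T u - T w) - M * rnorm (u - w)); lra.
(* Adding alpha^2 keeps N positive when M = 0 and gives s <= 1. With r = alpha / N the squared
   contraction factor is at most 1 - 2 s + r^2 M^2 <= 1 - s <= (1 - s/2)^2. *)
pose N := M ^+ 2 + alpha ^+ 2.
have N0 : 0 < N by rewrite ltr_wpDl ?sqr_ge0 ?exprn_gt0.
pose r := alpha / N; pose s := alpha ^+ 2 / N.
have rE : r * N = alpha by rewrite divfK// gt_eqF.
have sE : s = r * alpha by rewrite /s /r; ring.
have s0 : 0 < s by rewrite divr_gt0 ?exprn_gt0.
have s1 : s <= 1 by rewrite ler_pdivrMr// mul1r lerDr sqr_ge0.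
have r0 : 0 < r by rewrite divr_gt0.
have [u uF] : exists u, u - r%:C *: (T u - g) = u.
  apply: (@hilbert_fixed_point _ _ _ (1 - s / 2)); first by lra.
  move=> x y.
  have -> : x - r%:C *: (T x - g) - (y - r%:C *: (T y - g)) =
      (x - y) - r%:C *: (T x - T y).
    rewrite opprD opprK addrACA; congr (_ + _).
    by rewrite addrC -scalerBr -scalerN opprB opprB addrA subrK.
  rewrite -(ler_pXn2r (_ : 0 < 2)%N) ?nnegrE ?rnorm_ge0 ?mulr_ge0 ?rnorm_ge0//; last lra.
  rewrite sqr_rnormB rinnerZr rnormZr exprMn real_normK ?num_real//.
  have := ba (x - y); rewrite -TB => H1.
  have := TM x y; move: H1; rewrite -/(rinner (T x - T y) (x - y)) rinnerC.
  set p := rinner _ _; set d := rnorm (x - y); set t := rnorm (T x - T y) => H1 H2.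
  have e1 := ler_wpM2l (ltW r0) H1.
  have e2 := ler_wpM2l (sqr_ge0 r) H2.
  have rM : r ^+ 2 * M ^+ 2 <= s.
    have -> : s = r ^+ 2 * M ^+ 2 + r ^+ 2 * alpha ^+ 2.
      by transitivity (r * (r * N)); [rewrite rE | rewrite /N; ring].
    by rewrite lerDl mulr_ge0 ?sqr_ge0.
  have e3 := ler_wpM2r (sqr_ge0 d) rM.
  have e4 : s * d ^+ 2 = r * (alpha * d ^+ 2) by rewrite sE; ring.
  have e5 : 0 <= (s / 2) ^+ 2 * d ^+ 2 by rewrite mulr_ge0 ?sqr_ge0.
  lra.
exists u => v; rewrite TE gE; congr (inner _ v).
apply/subr0_eq; move/eqP: uF; rewrite -subr_eq0 addrAC subrr add0r oppr_eq0 scaler_eq0.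
by case/orP=> /eqP // [] r00; rewrite r00 ltxx in r0.
Qed.

(** * The uniform boundedness principle for a sequence of continuous seminorms *)

Section UniformBoundedness.
Context {R : realType} {V : hilbertType R}.
Variables (p : nat -> V -> R) (M : nat -> R).
Hypothesis pD : forall n u v, p n (u + v) <= p n u + p n v.
Hypothesis pZ : forall n (t : R) v, p n (t%:C *: v) = `|t| * p n v.
Hypothesis pM : forall n v, p n v <= M n * rnorm v.

Lemma seminormN n v : p n (- v) = p n v.
Proof. by have := pZ n (-1) v; rewrite rmorphN rmorph1 scaleN1r normrN normr1 mul1r. Qed.

(* One of [x + h] and [x - h] satisfies [p n h <= p n _], so a seminorm that is
   large somewhere is large near every point. *)
Lemma unbounded_seminorm_step (x : V) (r K : R) :
  (forall K', exists n v, K' * rnorm v < p n v) -> 0 < r ->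
  exists y r' n, [/\ 0 < r', r' <= r / 2, rnorm (y - x) <= r / 2 &
    forall z, rnorm (z - y) <= r' -> K < p n z].
Proof.
(* This factor makes p_n exceed |K| + 1 once [v] is rescaled to norm r / 2. *)
move=> /(_ (2 * (`|K| + 1) / r)) [n [v pv]] r0.
have v0 : 0 < rnorm v.
  rewrite lt_neqAle rnorm_ge0 andbT eq_sym; apply/negP => /eqP v0.
  by have := pM n v; rewrite v0 mulr0 leNgt; move: pv; rewrite v0 mulr0 => ->.
pose h := (r / 2 / rnorm v)%:C *: v.
have c0 : 0 < r / 2 / rnorm v by rewrite !divr_gt0.
have hr : rnorm h = r / 2 by rewrite rnormZr gtr0_norm// divfK// gt_eqF.
have ph : `|K| + 1 < p n h.
  have -> : `|K| + 1 = r / 2 / rnorm v * (2 * (`|K| + 1) / r * rnorm v).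
    by field; rewrite !gt_eqF.
  by rewrite pZ (gtr0_norm c0) ltr_pM2l.
have [y yx py] : exists2 y, rnorm (y - x) <= r / 2 & `|K| + 1 < p n y.
  have [px|px] := ltP (`|K| + 1) (p n (x + h)).
    by exists (x + h) => //; rewrite addrAC subrr add0r hr.
  exists (x - h); first by rewrite addrAC subrr add0r rnormN hr.
  (* The two arguments add up to 2 h, so p_n(x + h) and p_n(x - h) cannot both lie below p_n(h). *)
  have := pD n (x + h) (h - x).
  rewrite (addrC x h) addrACA subrr addr0 -mulr2n -scaler_nat -(rmorph_nat (real_complex R)).
  rewrite pZ normr_nat (addrC h x).
  rewrite -(seminormN _ (h - x)) opprB; lra.
(* On a ball of radius 1 / (|M_n| + 1) the seminorm varies by at most 1, the slack kept in |K| +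
   1. *)
exists y, (Num.min (r / 2) (`|M n| + 1)^-1), n; split=> //.
- by rewrite lt_min divr_gt0// invr_gt0 ltr_wpDl.
- by rewrite ge_min lexx.
move=> z zy.
have zM : p n (y - z) <= 1.
  rewrite -(seminormN _ (y - z)) opprB; apply: le_trans (pM _ _) _.
  have : rnorm (z - y) <= (`|M n| + 1)^-1 by apply: le_trans zy _; rewrite ge_min lexx orbT.
  have M1 : 0 < `|M n| + 1 by rewrite ltr_wpDl.
  rewrite -(ler_pM2l M1) divff ?gt_eqF//.
  have := ler_wpM2r (rnorm_ge0 (z - y)) (ler_norm (M n)).
  have := rnorm_ge0 (z - y); lra.
have := pD n z (y - z); rewrite addrC subrK.
have := ler_norm K; lra.
Qed.

(* Nested balls, on the k-th of which some [p n] exceeds k. *)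
Lemma uniform_boundedness :
  (forall v, exists K, forall n, p n v <= K) ->
  exists2 K : R, 0 <= K & forall n v, p n v <= K * rnorm v.
Proof.
move=> pb; apply: contrapT => nK.
have unb K' : exists n v, K' * rnorm v < p n v.
  apply: contrapT => H; apply: nK; exists `|K'| => // n v.
  rewrite leNgt; apply/negP => pv; apply: H; exists n, v.
  by apply: le_lt_trans pv; rewrite ler_wpM2r ?rnorm_ge0 ?ler_norm.
(* The input is a stage number with the centre and radius of a ball, the output the next ball and
   the index of a large seminorm. Positivity of the radius is a premise, so [F] is total, with a
   dummy value otherwise. *)
have /choice[F FE] (s : nat * (V * R)) : exists t : V * R * nat, 0 < s.2.2 ->
    [/\ 0 < t.1.2, t.1.2 <= s.2.2 / 2, rnorm (t.1.1 - s.2.1) <= s.2.2 / 2 &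
     forall z, rnorm (z - t.1.1) <= t.1.2 -> s.1%:R < p t.2 z].
  have [r0|r0] := ltP 0 s.2.2; last by exists (0, 0, 0%N).
  have [y [r' [n H]]] := unbounded_seminorm_step s.2.1 s.1%:R unb r0.
  by exists (y, r', n).
pose fix s k : V * R := if k is k'.+1 then (F (k', s k')).1 else (0, 1).
have s0 k : 0 < (s k).2.
  by elim: k => [|k IH] /=; [exact: ltr01 | have [] := FE (k, s k) IH].
have sS k := FE (k, s k) (s0 k).
pose x k := (s k).1; pose r k := (s k).2.
have r2 k : r k.+1 <= r k / 2 by have [] := sS k.
have x2 k : rnorm (x k.+1 - x k) <= r k / 2 by have [] := sS k.
have px k z : rnorm (z - x k.+1) <= r k.+1 -> k%:R < p (F (k, s k)).2 z.
  by have [_ _ _] := sS k; exact.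
have rlt k : r k <= 1 * 2^-1 ^+ k.
  elim: k => [|k IH]; first by rewrite expr0 mulr1.
  by apply: le_trans (r2 k) _; rewrite exprS; lra.
have rcvg : r n @[n --> \oo] --> 0.
  apply: (@squeeze_cvgr _ _ _ _ (fun=> 0) (fun k => 1 * 2^-1 ^+ k)).
  - by apply: nearW => k; rewrite rlt andbT ltW// s0.
  - exact: cvg_cst.
  - by apply: cvg_geometric_mul; lra.
have [l xl] : exists l, forall n, rnorm (l - x n) <= r n.
  apply: hilbert_complete rcvg _ => n m /subnKC <-.
  (* Since r_(k+1) <= r_k / 2, each step r_k / 2 is at most r_k - r_(k+1), and these bounds
     telescope. *)
  suff: rnorm (x (n + (m - n))%N - x n) <= r n - r (n + (m - n))%N.
    by have := s0 (n + (m - n))%N; rewrite -/(r _); lra.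
  elim: (m - n)%N => [|k IH]; first by rewrite addn0 !subrr rnorm0.
  rewrite addnS -(subrK (x (n + k)%N) (x _.+1)) -addrA.
  apply: le_trans (rnormD _ _) _.
  have := x2 (n + k)%N; have := r2 (n + k)%N; lra.
have [K lK] := pb l.
pose k := Num.Def.truncn `|K|.
have := lK (F (k.+1, s k.+1)).2; have := px k.+1 l (xl _).
have := truncnS_gt `|K|; have := ler_norm K; rewrite -/k; lra.
Qed.

End UniformBoundedness.

(** * Continuity against norm bounds, for linear maps and for forms *)

Lemma bounded_continuous (R : realType) (V W : hilbertType R) (T : {linear V -> W}) (K : R) :
  (forall v, rnorm (T v) <= K * rnorm v) -> continuous T.
Proof.
move=> TK x; apply/cvgrPdist_lt => e e0.
have eE : e = (complex.Re e)%:C by rewrite RRe_real// gtr0_real.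
have K1 : 0 < `|K| + 1 by rewrite ltr_wpDl.
have d0 : 0 < complex.Re e / (`|K| + 1) by rewrite divr_gt0// -ltcR -eE.
near=> y.
rewrite -linearB rnormE eE ltcR; apply: le_lt_trans (TK _) _.
have : rnorm (x - y) < complex.Re e / (`|K| + 1).
  by rewrite -ltcR -rnormE; near: y; apply: cvgr_dist_lt; rewrite ?ltcR//; exact: cvg_id.
rewrite ltr_pdivlMr// => H; apply: le_lt_trans H.
by rewrite [leRHS]mulrC ler_wpM2r ?rnorm_ge0// ler_wpDr// ler_norm.
Unshelve. all: by end_near. Qed.

Lemma near0_rnorm (R : realType) (V : hilbertType R) (P : set V) :
  nbhs 0 P -> exists2 e : R, 0 < e & forall v, rnorm v < e -> P v.
Proof.
move=> /nbhs_ballP [e /= e0 eP].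
have eE : e = (complex.Re e)%:C by rewrite RRe_real// gtr0_real.
exists (complex.Re e); first by rewrite -ltcR -eE.
by move=> v ve; apply: eP; rewrite -ball_normE/= sub0r normrN rnormE eE ltcR.
Qed.

Lemma continuous_bounded (R : realType) (V W : hilbertType R) (T : {linear V -> W}) :
  continuous T -> exists2 K : R, 0 <= K & forall v, rnorm (T v) <= K * rnorm v.
Proof.
move=> cT.
have /near0_rnorm [e e0 eT] : \forall v \near (0 : V), `|T v| < 1.
  have /cvgrPdist_lt /(_ 1 ltr01) := cT 0; rewrite linear0.
  by apply: filterS => v; rewrite sub0r normrN.
have e20 : 0 < e / 2 by rewrite divr_gt0.
exists (2 / e) => [|v]; first by rewrite divr_ge0// ltW.
have [v0|v0] := eqVneq (rnorm v) 0.
  by rewrite v0 mulr0 (rnorm0_eq0 v0) linear0 rnorm0.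
have {}v0 : 0 < rnorm v by rewrite lt_neqAle eq_sym v0 rnorm_ge0.
have c0 : 0 < e / 2 / rnorm v by rewrite divr_gt0.
have := eT ((e / 2 / rnorm v)%:C *: v).
rewrite linearZ rnormE !rnormZr gtr0_norm// divfK ?gt_eqF// ltcR => /(_ ltac:(lra)) /ltW.
rewrite -(ler_pM2l c0 (rnorm (T v))).
suff -> : e / 2 / rnorm v * (2 / e * rnorm v) = 1 by [].
by field; rewrite !gt_eqF.
Qed.

Lemma bounded_form_continuous (R : realType) (V : hilbertType R) (b : sesquilinear_form V)
    (M : R) : 0 <= M -> form_bounded b M -> continuous_form b.
Proof.
move=> M0 bM [x y]; apply/cvgrPdist_lt => /= e e0.
have eE : e = (complex.Re e)%:C by rewrite RRe_real// gtr0_real.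
set e' := complex.Re e in eE; have e'0 : 0 < e' by rewrite -ltcR -eE.
(* For d <= 1 the two error terms add up to at most d M (|x| + |y| + 1), strictly below d N. *)
pose N := M * (rnorm x + rnorm y + 2) + 1.
have N0 : 0 < N by rewrite ltr_wpDl// mulr_ge0// !addr_ge0// rnorm_ge0.
pose d := Num.min 1 (e' / N).
have d0 : 0 < d by rewrite lt_min ltr01 divr_gt0.
exists (ball x d%:C, ball y d%:C); first by split; apply: nbhsx_ballx; rewrite ltcR.
move=> [u v] /= []; rewrite -!ball_normE/= !rnormE !ltcR => xu yv.
have -> : b x y - b u v = b (x - u) y + b u (y - v).
  by rewrite linearBl linearBr addrA subrK.
rewrite eE; apply: le_lt_trans (ler_normD _ _) _.
apply: le_lt_trans (lerD (bM _ _) (bM _ _)) _; rewrite -rmorphD ltcR.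
have d1 : d <= 1 by rewrite ge_min lexx.
have dN : d * N <= e' by rewrite -ler_pdivlMr// ge_min lexx orbT.
have ux : rnorm u <= rnorm x + 1.
  rewrite -(subrK x u) addrC; apply: le_trans (rnormD _ _) _.
  by rewrite lerD2l rnormC (le_trans (ltW xu)).
apply: lt_le_trans dN.
have h1 : M * rnorm (x - u) * rnorm y <= M * d * rnorm y.
  by rewrite ler_wpM2r ?rnorm_ge0// ler_wpM2l// ltW.
have h2 : M * rnorm u * rnorm (y - v) <= M * (rnorm x + 1) * d.
  by apply: ler_pM; rewrite ?mulr_ge0 ?rnorm_ge0 ?ler_wpM2l// ltW.
apply: le_lt_trans (lerD h1 h2) _; rewrite /N.
have := mulr_ge0 M0 (ltW d0); lra.
Qed.

(** Continuity at the origin bounds the form by 1 on a ball of radius e; rescaling both arguments to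
    norm e / 2 gives the constant (2 / e)^2. *)
Lemma continuous_form_bounded (R : realType) (V : hilbertType R) (b : sesquilinear_form V) :
  continuous_form b -> exists2 M : R, 0 <= M & form_bounded b M.
Proof.
move=> cb.
have [e e0 eb] : exists2 e : R, 0 < e &
    forall u v, rnorm u < e -> rnorm v < e -> `|b u v| < 1.
  have /cvgrPdist_lt /(_ 1 ltr01) /= := cb (0, 0).
  rewrite /= linear0l => -[[P Q] /= [/near0_rnorm [e e0 eP] /near0_rnorm [e' e'0 eQ]] PQ].
  exists (Num.min e e') => [|u v]; first by rewrite lt_min e0.
  rewrite !lt_min => /andP[ue _] /andP[_ ve].
  by have := PQ (u, v) (conj (eP _ ue) (eQ _ ve)); rewrite /= sub0r normrN.
exists ((2 / e) ^+ 2) => [|u v]; first exact: sqr_ge0.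
have [u0|u0] := eqVneq (rnorm u) 0.
  by rewrite (rnorm0_eq0 u0) linear0l normr0 rnorm0 mulr0 mul0r.
have [v0|v0] := eqVneq (rnorm v) 0.
  by rewrite (rnorm0_eq0 v0) linear0r normr0 rnorm0 mulr0.
have {}u0 : 0 < rnorm u by rewrite lt_neqAle eq_sym u0 rnorm_ge0.
have {}v0 : 0 < rnorm v by rewrite lt_neqAle eq_sym v0 rnorm_ge0.
pose c (w : V) : R := e / 2 / rnorm w.
have c0 w : 0 < rnorm w -> 0 < c w by move=> w0; rewrite !divr_gt0.
have ce w : 0 < rnorm w -> rnorm ((c w)%:C *: w) < e.
  by move=> w0; rewrite rnormZr gtr0_norm ?c0// divfK ?gt_eqF//; lra.
have := eb _ _ (ce u u0) (ce v v0); rewrite linearZl_LR linearZr_LR/= conj_real.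
rewrite !normrM !norm_real_complex (gtr0_norm (c0 u u0)) (gtr0_norm (c0 v v0)).
rewrite -(RRe_real (normr_real (b u v))) -!rmorphM -(rmorph1 (real_complex R)) ltcR lecR.
move=> /ltW H; rewrite -(ler_pM2l (c0 v v0)) -(ler_pM2l (c0 u u0)).
apply: le_trans H _; rewrite le_eqVlt; apply/orP; left; apply/eqP.
by rewrite /c; field; rewrite !gt_eqF.
Qed.

(** * Resolvents of accretive operators *)

Definition shift_onto (R : realType) (H : hilbertType R) (A : operator H) (lam : R) :=
  forall y, exists2 x, op_dom A x & op_shift A lam x = y.

Lemma accretive_shift_ge (R : realType) (H : hilbertType R) (A : operator H) (lam : R) x :
  accretive A -> op_dom A x -> lam * rnorm x <= rnorm (op_shift A lam x).
Proof.
move=> accA /accA; rewrite -complexRe ler0c -/(rinner (A x) x) => Ax.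
have [x0|x0] := eqVneq (rnorm x) 0; first by rewrite x0 mulr0 rnorm_ge0.
have {}x0 : 0 < rnorm x by rewrite lt_neqAle eq_sym x0 rnorm_ge0.
rewrite -(ler_pM2r x0); apply: le_trans (le_rinner _ _).
by rewrite rinnerDl rinnerZl -rnorm_sqr; lra.
Qed.

Lemma opB (R : realType) (H : hilbertType R) (A : operator H) x y :
  op_dom A x -> op_dom A y -> op_dom A (x - y) /\ A (x - y) = A x - A y.
Proof.
move=> Dx Dy; rewrite addrC -scaleN1r; split; first exact: op_domP.
by rewrite op_linear// scaleN1r addrC.
Qed.

Lemma accretive_shift_inj (R : realType) (H : hilbertType R) (A : operator H) (lam : R) x y :
  accretive A -> 0 < lam -> op_dom A x -> op_dom A y ->
  op_shift A lam x = op_shift A lam y -> x = y.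
Proof.
move=> accA lam0 Dx Dy xy.
have [Dxy Axy] := opB (A := op_shift A lam) Dx Dy.
have := accretive_shift_ge lam accA Dxy; rewrite Axy xy subrr rnorm0 pmulr_rle0// => H0.
by apply/subr0_eq/rnorm0_eq0/eqP; rewrite eq_le H0 rnorm_ge0.
Qed.

(** The lower bound [accretive_shift_ge] makes the shifted operator injective, hence its inverse
    single-valued and linear, and bounds that inverse by 1 / lam. *)
Lemma accretive_resolvent (R : realType) (H : hilbertType R) (A : operator H) (lam : R) :
  accretive A -> 0 < lam -> shift_onto A lam ->
  exists2 S : {linear H -> H}, bounded_inverse (op_shift A lam) S &
    forall y, rnorm (S y) <= lam^-1 * rnorm y.
Proof.
move=> accA lam0 onto.
have /choice[f fE] y : exists x, op_dom A x /\ op_shift A lam x = y.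
  by have [x] := onto y; exists x.
have flin : linear f.
  move=> c x y; have [[[Dx xE] [Dy yE]] [Dxy xyE]] := (fE x, fE y, fE (c *: x + y)).
  apply: (accretive_shift_inj accA lam0 Dxy); first exact: op_domP.
  by rewrite xyE (op_linear (o := op_shift A lam))// xE yE.
pose S : {linear H -> H} := HB.pack f (GRing.isLinear.Build R[i] H H *:%R f flin).
have SE y : rnorm (S y) <= lam^-1 * rnorm y.
  have [Dy yE] := fE y; rewrite -(ler_pM2l lam0) mulVKf ?gt_eqF//.
  by rewrite -[in leRHS]yE; exact: accretive_shift_ge.
exists S => //; split; first exact: bounded_continuous SE.
- exact: fE.
- move=> x Dx; have [Dy yE] := fE (op_shift A lam x).
  exact: (accretive_shift_inj accA lam0 Dy Dx).
Qed.

(** (lam + A) x = y is the fixed point equation x = (mu + A)^-1 (y + (mu - lam) x), a contraction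
    because |mu - lam| < mu. *)
Lemma shift_onto_near (R : realType) (H : hilbertType R) (A : operator H) (mu lam : R) :
  accretive A -> 0 < lam < 2 * mu -> shift_onto A mu -> shift_onto A lam.
Proof.
move=> accA lam2mu onto y; have mu0 : 0 < mu by lra.
have [S [_ SI _] SM] := accretive_resolvent accA mu0 onto.
have [x xE] : exists x, S (y + (mu - lam)%:C *: x) = x.
  apply: (@hilbert_fixed_point _ _ _ (mu^-1 * `|mu - lam|)) => [|x z].
    rewrite mulr_ge0 ?invr_ge0 ?(ltW mu0)//= mulrC ltr_pdivrMr// mul1r.
    by rewrite ltr_norml; lra.
  rewrite -linearB opprD addrACA subrr add0r -scalerBr.
  by apply: le_trans (SM _) _; rewrite rnormZr mulrA.
have [Dx AE] := SI (y + (mu - lam)%:C *: x); rewrite xE in Dx AE.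
exists x => //; apply: (addIr ((mu - lam)%:C *: x)); rewrite -AE /=.
by rewrite -addrA -scalerDl -rmorphD/= [lam + _]addrC subrK.
Qed.

(** Surjectivity climbs from 1 through the powers of 3/2, each step being by a factor below 2; once
    2 (3/2)^n exceeds [lam], a single step reaches [lam]. *)
Lemma m_accretive_onto (R : realType) (H : hilbertType R) (A : operator H) (lam : R) :
  m_accretive A -> 0 < lam -> shift_onto A lam.
Proof.
move=> [accA onto1] lam0.
have onto n : shift_onto A ((3 / 2) ^+ n).
  elim: n => [|n]; first by rewrite expr0.
  apply: shift_onto_near => //; have : 0 < (3 / 2 : R) ^+ n by rewrite exprn_gt0.
  by rewrite exprS; lra.
have [n nlam] : exists n, lam < 2 * (3 / 2) ^+ n.
  have : (2 / 3 : R) ^+ n @[n --> \oo] --> 0 by apply: cvg_expr; rewrite ger0_norm; lra.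
  have l0 : 0 < 2 / lam by rewrite divr_gt0.
  move=> /cvgrPdist_lt /(_ (2 / lam) l0) [n _ /(_ n (leqnn n))] /=.
  rewrite sub0r normrN ger0_norm ?exprn_ge0// => H1; exists n.
  have a0 : 0 < (3 / 2 : R) ^+ n by rewrite exprn_gt0.
  have := H1; rewrite ltr_pdivlMr// -(ltr_pM2r a0) mulrAC -exprMn.
  by rewrite (_ : 2 / 3 * (3 / 2) = 1) ?expr1n ?mul1r//; field.
by apply: shift_onto_near (onto n) => //; rewrite lam0.
Qed.

(** If f is nonzero, some j v lies closer to f than |f|; then |f|^2 = Re (f | f - j v) < |f|^2. *)
Lemma dense_inner0 (R : realType) (V H : hilbertType R) (j : {linear V -> H}) (f : H) :
  dense (range j) -> (forall v, inner f (j v) = 0) -> f = 0.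
Proof.
move=> dj f0; apply: contrapT => /eqP fN0.
have nf0 : 0 < rnorm f.
  by rewrite lt_neqAle rnorm_ge0 andbT eq_sym; apply: contraNneq fN0 => /rnorm0_eq0 ->.
have nfC : 0 < (rnorm f)%:C by rewrite ltcR.
have [|x [fv [v _ vE]]] := dj (ball f (rnorm f)%:C) _ (ball_open _ _).
  by exists f; apply: ballxx.
move: fv; rewrite -vE -ball_normE/= rnormE ltcR => fv.
have := le_rinner f (f - j v); rewrite rinnerBr -rnorm_sqr /rinner f0 subr0.
by rewrite expr2 ler_pM2l// leNgt fv.
Qed.

Lemma inner_CS (R : realType) (W : hilbertType R) (x y : W) :
  `|inner x y| <= (rnorm x * rnorm y)%:C.
Proof.
(* Rotating [x] by the phase of [inner x y] makes the inner product real. *)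
set z := inner x y.
have [z0|z0] := eqVneq z 0.
  by rewrite z0 normr0 ler0c mulr_ge0 ?rnorm_ge0.
have nz0 : `|z| != 0 by rewrite normr_eq0.
pose c := Num.conj z / `|z|.
have cz : inner (c *: x) y = `|z|.
  by rewrite linearZl_LR/= -/z /c mulrAC (mulrC _ z) -normCK expr2 mulfK.
have nc : complex.Re `|c| = 1 by rewrite normrM normfV normr_id norm_conjC divff.
by have := le_rinner (c *: x) y; rewrite rnormZ nc mul1r /rinner cz -lecR RRe_real.
Qed.

(** * The operator associated with a bounded coercive form *)

Section FormOperator.
Context {R : realType} {V H : hilbertType R}.
Variables (b : sesquilinear_form V) (j : {linear V -> H}).

Definition shifted_fun (lam : R) (u v : V) : R[i] :=
  b u v + lam%:C * inner (j u) (j v).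

Lemma shifted_fun_bilinear (lam : R) :
  @bilinear_for R[i] V V R[i] *%R (@Num.conj R[i] \; *%R) (shifted_fun lam).
Proof.
split=> [v|u] c x y; rewrite /shifted_fun (linearP j).
  by rewrite !linearPl/=; ring.
by rewrite linearPr [inner _ _]linearPr/=; ring.
Qed.

HB.instance Definition _ (lam : R) :=
  bilinear_isBilinear.Build R[i] V V R[i] *%R (@Num.conj R[i] \; *%R)
    (shifted_fun lam) (shifted_fun_bilinear lam).

Definition shifted_form (lam : R) : sesquilinear_form V := shifted_fun lam.

Variables (M K alpha : R).
Hypotheses (bM : form_bounded b M) (jK : forall v, rnorm (j v) <= K * rnorm v).
Hypotheses (alpha0 : 0 < alpha)
  (b_coercive : forall u, alpha * rnorm u ^+ 2 <= complex.Re (b u u)).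
Hypothesis j_dense : dense (range j).

(** Lax-Milgram for the shifted form: the added term is nonnegative on the diagonal, so [alpha]
    remains a coercivity constant. *)
Lemma form_resolvent_onto (lam : R) (y : H) : 0 <= lam ->
  exists u, forall v, b u v + lam%:C * inner (j u) (j v) = inner y (j v).
Proof.
move=> lam0; apply: (@lax_milgram _ _ (shifted_form lam) (M + lam * K ^+ 2) alpha (rnorm y * K)).
- move=> u v; apply: le_trans (ler_normD _ _) _; rewrite normrM.
  rewrite !mulrDl rmorphD/=; apply: lerD; first exact: bM.
  rewrite norm_real_complex (ger0_norm lam0).
  apply: le_trans (ler_wpM2l _ (inner_CS _ _)) _; first by rewrite ler0c.
  rewrite -rmorphM lecR -!mulrA ler_wpM2l//.
  have := ler_pM (rnorm_ge0 _) (rnorm_ge0 _) (jK u) (jK v); lra.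
- by [].
- move=> u; apply: le_trans (b_coercive u) _.
  by rewrite ReD lerDl ReZ -/(rinner _ _) -rnorm_sqr mulr_ge0 ?sqr_ge0.
- by move=> c u v; rewrite linearD linearZ linearDr linearZr_LR.
- move=> v; apply: le_trans (inner_CS _ _) _; rewrite lecR -mulrA ler_wpM2l ?rnorm_ge0//.
Qed.

(** The graph of the future operator, kept as a relation because [j] may identify several [u]. *)
Definition form_rel (x f : H) := exists2 u, j u = x & forall v, b u v = inner f (j v).

(** Coercivity stands in for injectivity of [j]: testing with u - w, which [j] sends to 0, gives b(u
    - w, u - w) = 0, so u = w; density of the range then gives f = g. *)
Lemma form_rel_fun x f g : form_rel x f -> form_rel x g -> f = g.
Proof.
move=> [u ux uf] [w wx wg].
have E v : b (u - w) v = inner (f - g) (j v) by rewrite !linearBl uf wg.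
have uw : u - w = 0.
  apply: rnorm0_eq0; apply/eqP; rewrite -sqrf_eq0 eq_le sqr_ge0 andbT.
  have := b_coercive (u - w); rewrite E linearB ux wx subrr linear0r/= pmulr_rle0//.
apply: subr0_eq; apply: (dense_inner0 j_dense) => v.
by rewrite -E uw linear0l.
Qed.

Lemma form_rel_linear (c : R[i]) x y f g :
  form_rel x f -> form_rel y g -> form_rel (c *: x + y) (c *: f + g).
Proof.
move=> [u ux uf] [w wy wg]; exists (c *: u + w); first by rewrite linearP ux wy.
by move=> v; rewrite !linearPl uf wg.
Qed.

Definition form_op_fun (x : H) : H := xget 0 [set f | form_rel x f].

Lemma form_op_funE x f : form_rel x f -> form_op_fun x = f.
Proof.
move=> xf; apply: form_rel_fun (xf).
by apply: (@xgetPex _ 0 [set g | form_rel x g]); exists f.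
Qed.

Program Definition form_op : operator H :=
  @Operator R H [set x | exists f, form_rel x f] form_op_fun _ _ _.
Next Obligation.
by exists 0, 0 => [|v]; rewrite ?linear0// !linear0l.
Qed.
Next Obligation.
move=> c x y [f xf] [g yg]; exists (c *: f + g); exact: form_rel_linear.
Qed.
Next Obligation.
move=> c x y [f xf] [g yg] /=; rewrite (form_op_funE xf) (form_op_funE yg).
exact/form_op_funE/form_rel_linear.
Qed.

Lemma form_op_associated : associated b j form_op.
Proof.
split.
  apply/seteqP; split=> [x [f [u ux uf]]|_ [u [f uf] <-]].
    by exists u => //; exists f.
  by exists f, u.
move=> u [f uf] v; rewrite uf; congr (inner _ _).
by symmetry; apply: form_op_funE; exists u.
Qed.

Lemma form_op_accretive : accretive form_op.
Proof.
move=> _ [f [u <- uf]]; have ju : form_rel (j u) f by exists u.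
rewrite /= (form_op_funE ju) -uf -complexRe ler0c.
by apply: le_trans (b_coercive u); rewrite mulr_ge0 ?sqr_ge0// ltW.
Qed.

Lemma form_op_onto (lam : R) : 0 <= lam -> shift_onto form_op lam.
Proof.
move=> lam0 y; have [u uy] := form_resolvent_onto y lam0.
have ju : form_rel (j u) (y - lam%:C *: j u).
  exists u => // v; rewrite linearBl linearZl_LR/= -uy; ring.
exists (j u); first by exists (y - lam%:C *: j u).
by rewrite /= (form_op_funE ju) subrK.
Qed.

(** Vertex 0 works, with tangent M / alpha: |Im b(u,u)| <= M |u|^2 <= (M / alpha) Re b(u,u). *)
Lemma form_op_m_sectorial : 0 <= M -> m_sectorial form_op.
Proof.
move=> M0; have shift0 x : op_shift form_op (- 0) x = form_op x.
  by rewrite /= oppr0 scale0r addr0.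
exists 0, (atan (M / alpha)); split.
- by rewrite atan_ltpi2 andbT -(atan0 R) le_atan// divr_ge0// ltW.
- move=> _ [f [u <- uf]]; have ju : form_rel (j u) f by exists u.
  rewrite shift0 /= (form_op_funE ju) -uf atanK -complexRe -complexIm norm_real_complex.
  rewrite -rmorphM lecR.
  apply: (@le_trans _ _ (M * rnorm u ^+ 2)).
    rewrite -lecR; apply: le_trans (_ : _ <= `|b u u|) _; last by rewrite expr2 mulrA; exact: bM.
    by rewrite normc_def lecR -sqrtr_sqr ler_wsqrtr// lerDr sqr_ge0.
  by rewrite -mulrA ler_wpM2l// (mulrC alpha^-1) ler_pdivlMr// mulrC.
- split=> [x Dx|y]; first by rewrite shift0; exact: form_op_accretive.
  have [x Dx xy] := form_op_onto ler01 y; exists x => //.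
  by rewrite -xy /= oppr0 scale0r addr0.
Qed.

End FormOperator.

(** * Off-diagonal estimates for sectorial operators *)

Lemma tan_ge0 (R : realType) (theta : R) : 0 <= theta < pi / 2 -> 0 <= tan theta.
Proof.
move=> /andP[t0 t1]; have := pi_gt0 R => p0; rewrite divr_ge0//.
  by apply: sin_ge0_pi; rewrite t0/=; lra.
by apply: cos_ge0_pihalf; rewrite (ltW t1) andbT; lra.
Qed.

(* Polarization bounds the full form of a sectorial operator by its values on
   the diagonal. *)
Lemma sectorial_Re_le (R : realType) (V : hilbertType R) (B : {linear V -> V})
    (theta eps : R) :
  0 <= tan theta -> sectorial (total_operator B) 0 theta ->
  (forall u, 0 <= rinner (B u) u <= eps * rnorm u ^+ 2) ->
  forall u v, rinner (B u) v <= (1 + tan theta) * eps * (rnorm u ^+ 2 + rnorm v ^+ 2) / 2.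
Proof.
move=> tan0 Bsec Beps u v.
have BIm w : `|complex.Im (inner (B w) w)| <= tan theta * (eps * rnorm w ^+ 2).
  have := Bsec w I; rewrite /= oppr0 scale0r addr0 -complexRe -complexIm.
  rewrite norm_real_complex -rmorphM lecR => /le_trans; apply.
  by rewrite ler_wpM2l//; have /andP[] := Beps w.
pose iv := 'i%C *: v.
have niv : rnorm iv = rnorm v.
  by rewrite rnormZ normc_def /= expr0n expr1n add0r sqrtr1 mul1r.
have par : rnorm (u + iv) ^+ 2 + rnorm (u - iv) ^+ 2 = 2 * (rnorm u ^+ 2 + rnorm v ^+ 2).
  by rewrite sqr_rnormD sqr_rnormB niv; ring.
have par1 : rnorm (u + v) ^+ 2 + rnorm (u - v) ^+ 2 = 2 * (rnorm u ^+ 2 + rnorm v ^+ 2).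
  by rewrite sqr_rnormD sqr_rnormB; ring.
(* The real diagonal values give only Re (B u | v) + Re (B v | u); the imaginary ones at u + iv and
   u - iv supply the difference, and sectoriality controls them. *)
have pol : 4 * rinner (B u) v = rinner (B (u + v)) (u + v) - rinner (B (u - v)) (u - v)
    - complex.Im (inner (B (u + iv)) (u + iv)) + complex.Im (inner (B (u - iv)) (u - iv)).
  have E c : inner (B (u + c *: v)) (u + c *: v) = inner (B u) u + Num.conj c * inner (B u) v
      + c * (inner (B v) u + Num.conj c * inner (B v) v).
    have ED z : inner z (u + c *: v) = inner z u + Num.conj c * inner z v.
      by rewrite linearDr linearZr_LR.
    by rewrite (linearD B) linearZ/= linearDl linearZl_LR/= !ED; ring.
  have := (E 1, E (-1), E 'i%C, E (- 'i%C)).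
  rewrite scale1r !scaleNr scale1r -/iv /rinner => -[[[-> ->] ->] ->].
  case: (inner (B u) v) (inner (B v) u) (inner (B u) u) (inner (B v) v)
    => [b1 b2] [c1 c2] [e1 e2] [f1 f2] /=; ring.
have /andP[_ h1] := Beps (u + v); have /andP[h2 h7] := Beps (u - v).
have := BIm (u + iv); have := BIm (u - iv); rewrite !ler_norml => /andP[_ h3] /andP[h4 _].
have h5 : tan theta * (eps * rnorm (u + iv) ^+ 2) + tan theta * (eps * rnorm (u - iv) ^+ 2)
    = tan theta * eps * (2 * (rnorm u ^+ 2 + rnorm v ^+ 2)) by rewrite -par; ring.
have h6 : rinner (B (u + v)) (u + v) <= eps * (2 * (rnorm u ^+ 2 + rnorm v ^+ 2)).
  by rewrite -par1 mulrDr; lra.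
lra.
Qed.

(** Replacing u, v by t u, v / t leaves Re (B u | v) unchanged; t is chosen so that the coefficient
    of |u|^2 becomes exactly [delta]. *)
Lemma sectorial_Re_young (R : realType) (V : hilbertType R) (B : {linear V -> V})
    (theta eps delta : R) :
  0 <= tan theta -> 0 < eps -> 0 < delta -> sectorial (total_operator B) 0 theta ->
  (forall u, 0 <= rinner (B u) u <= eps * rnorm u ^+ 2) ->
  forall u v, rinner (B u) v <=
    delta * rnorm u ^+ 2 + (1 + tan theta) ^+ 2 / 4 * (eps ^+ 2 / delta) * rnorm v ^+ 2.
Proof.
move=> tan0 eps0 delta0 Bsec Beps u v.
set C := 1 + tan theta; have C0 : 0 < C by rewrite ltr_pwDl.
have D0 : 0 < C * eps by rewrite mulr_gt0.
pose t := Num.sqrt (2 * delta / (C * eps)).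
have t20 : 0 < 2 * delta / (C * eps) by rewrite divr_gt0// mulr_gt0.
have t0 : 0 < t by rewrite sqrtr_gt0.
have tE : t ^+ 2 = 2 * delta / (C * eps) by rewrite sqr_sqrtr// ltW.
have := sectorial_Re_le tan0 Bsec Beps (t%:C *: u) (t^-1%:C *: v).
rewrite linearZ rinnerZl rinnerZr mulVKf ?gt_eqF// !rnormZr !exprMn !real_normK ?num_real//.
rewrite exprVn tE -/C => /le_trans; apply; rewrite le_eqVlt; apply/orP; left; apply/eqP.
by field; rewrite !gt_eqF.
Qed.

(** * Operator norms and the resolvent difference on a fixed datum *)

Lemma opnorm_le (R : realType) (H : hilbertType R) (T : H -> H) (K : R) :
  0 <= K -> (forall x, rnorm (T x) <= K * rnorm x) -> 0 <= opnorm T <= K.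
Proof.
move=> K0 TK; rewrite /opnorm; set E := [set _ | _ in _].
(* With this bound and the element coming from x = 0, [sup] is a genuine supremum and not its
   default value. *)
have EK : ubound E K.
  move=> _ [x /= x1 <-]; apply: le_trans (TK x) _.
  by rewrite -[leRHS]mulr1 ler_wpM2l// -lecR -rnormE.
have E0 : E (rnorm (T 0)) by exists 0 => //=; rewrite normr0.
apply/andP; split; last by apply: ge_sup => //; exists (rnorm (T 0)).
apply: le_trans (rnorm_ge0 (T 0)) _; apply: ub_le_sup => //; by exists K.
Qed.

(** Translates resolvents into form equations, on which the perturbation argument runs; only
    existence of a preimage [u] is claimed. *)
Lemma associated_resolvent (R : realType) (V H : hilbertType R) (b : sesquilinear_form V)
    (j : {linear V -> H}) (A : operator H) (S : {linear H -> H}) (lam : R) (f : H) :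
  associated b j A -> bounded_inverse (op_shift A lam) S ->
  exists2 u, j u = S f & forall v, b u v + lam%:C * inner (j u) (j v) = inner f (j v).
Proof.
move=> [AD bA] [_ SI _]; have [] := SI f; rewrite /= AD => -[u bu uE] AE.
exists u => // v; rewrite (bA u bu) -[in RHS]AE -uE linearDl; congr (_ + _).
by rewrite linearZl_LR.
Qed.

Lemma perturbed_formE (R : realType) (V : hilbertType R) (a : sesquilinear_form V)
    (B : {linear V -> V}) (u v : V) :
  perturbed_form a B u v = a u v + inner (B u) v.
Proof. by []. Qed.

Lemma perturbation_estimate (R : realType) (V H : hilbertType R) (a : sesquilinear_form V)
    (B : {linear V -> V}) (j : {linear V -> H}) (theta eps delta lam : R) (f : H) (u w : V) :
  accretive_form a -> 0 <= tan theta -> 0 < eps -> 0 < delta -> 0 < lam ->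
  sectorial (total_operator B) 0 theta ->
  (forall u, delta * rnorm u ^+ 2 <= rinner (B u) u <= eps * rnorm u ^+ 2) ->
  (forall v, a u v + lam%:C * inner (j u) (j v) = inner f (j v)) ->
  (forall v, perturbed_form a B w v + lam%:C * inner (j w) (j v) = inner f (j v)) ->
  lam * rnorm (j w - j u) ^+ 2 <=
    (1 + tan theta) ^+ 2 / 4 * (eps ^+ 2 / delta) * rnorm u ^+ 2.
Proof.
move=> acca tan0 eps0 delta0 lam0 Bsec Bb uE wE.
have Bge0 x : 0 <= rinner (B x) x <= eps * rnorm x ^+ 2.
  have /andP[Bx ->] := Bb x; rewrite andbT (le_trans _ Bx)//.
  by rewrite mulr_ge0 ?sqr_ge0// ltW.
have E : a (w - u) (w - u) + lam%:C * inner (j w - j u) (j w - j u) + inner (B w) (w - u) = 0.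
  have := wE (w - u); rewrite -(uE (w - u)) perturbed_formE.
  move=> /eqP; rewrite -subr_eq0 => /eqP <-.
  have aB v : a (w - u) v = a w v - a u v by rewrite linearBl.
  have iB (x : H) : inner (j w - j u) x = inner (j w) x - inner (j u) x by rewrite linearBl.
  by rewrite aB (linearB j) iB; ring.
have := congr1 (@complex.Re R) E; rewrite !ReD ReZ linearBr ReB /=.
rewrite -!/(rinner _ _) -rnorm_sqr.
have := acca (w - u); rewrite -complexRe ler0c.
have := sectorial_Re_young tan0 eps0 delta0 Bsec Bge0 w u.
have /andP[] := Bb w; lra.
Qed.

Unset Implicit Arguments.

Theorem theorem6p1 (R : realType) (V H : hilbertType R)
    (a : sesquilinear_form V) (j : {linear V -> H}) (A : operator H)
    (a_continuous : continuous_form a) (a_accretive : accretive_form a)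
    (j_bounded : continuous j) (j_dense : dense (range j))
    (aA : associated a j A) (A_m_accretive : m_accretive A)
    (theta : R) (theta_range : 0 <= theta < pi / 2)
    (B : nat -> {linear V -> V})
    (B_bounded : forall n, continuous (B n))
    (B_sectorial : forall n, sectorial (total_operator (B n)) 0 theta)
    (delta eps : nat -> R)
    (delta_gt0 : forall n, 0 < delta n) (eps_gt0 : forall n, 0 < eps n)
    (eps2_delta : eps n ^+ 2 / delta n @[n --> \oo] --> (0 : R))
    (B_bounds : forall n (u : V),
      (delta n)%:C * `|u| ^+ 2 <= 'Re (inner (B n u) u)
        <= (eps n)%:C * `|u| ^+ 2) :
  (forall n, j_elliptic j (perturbed_form a (B n)) /\
             continuous_form (perturbed_form a (B n))) /\
  exists A_ : nat -> operator H,
    (forall n, associated (perturbed_form a (B n)) j (A_ n) /\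
               m_sectorial (A_ n)) /\
    norm_resolvent_cvg A_ A.
Proof.
have [Ma Ma0 aM] := continuous_form_bounded a_continuous.
have [Kj _ jK] := continuous_bounded j_bounded.
have tan0 := tan_ge0 theta_range.
have Bb n u : delta n * rnorm u ^+ 2 <= rinner (B n u) u <= eps n * rnorm u ^+ 2.
  have := B_bounds n u; rewrite rnormE -complexRe -!rmorphXn/= -!rmorphM/= !lecR.
  exact.
have an_coercive n u : delta n * rnorm u ^+ 2 <= complex.Re (perturbed_form a (B n) u u).
  have := a_accretive u; rewrite -complexRe ler0c perturbed_formE ReD => au.
  by have /andP[Bu _] := Bb n u; rewrite (le_trans Bu)// lerDr.
(* This bound may depend on [n]: it serves continuity, solvability and sectoriality for each [n],
   not the rate. *)
have /choice[M MB] n : exists M : R, 0 <= M /\ form_bounded (perturbed_form a (B n)) M.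
  have [K K0 BK] := continuous_bounded (B_bounded n).
  exists (Ma + K); split; first exact: addr_ge0.
  move=> u v; rewrite perturbed_formE; apply: le_trans (ler_normD _ _) _.
  rewrite !mulrDl rmorphD/=; apply: lerD; first exact: aM.
  by apply: le_trans (inner_CS _ _) _; rewrite lecR ler_wpM2r ?rnorm_ge0.
split=> [n|].
  have [Mn0 Mn] := MB n; split; last exact: bounded_form_continuous Mn.
  (* Ellipticity holds with omega = 0, as the perturbation alone is coercive on [V]. *)
  exists 0, (delta n); split=> // u; rewrite mul0r addr0 rnormE -complexRe.
  by rewrite -rmorphXn -rmorphM lecR an_coercive.
pose A_ n := form_op (delta_gt0 n) (an_coercive n) j_dense.
have A_as n : associated (perturbed_form a (B n)) j (A_ n) by exact: form_op_associated.
have A_acc n : accretive (A_ n) by exact: form_op_accretive.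
exists A_; split=> [n|lam lam0].
  by have [Mn0 Mn] := MB n; split => //; exact: form_op_m_sectorial Mn jK _ _ _ Mn0.
have /choice[S_ S_P] n : exists S : {linear H -> H}, bounded_inverse (op_shift (A_ n) lam) S /\
    forall y, rnorm (S y) <= lam^-1 * rnorm y.
  have [Mn0 Mn] := MB n.
  have [|S SI SM] := accretive_resolvent (A_acc n) lam0.
    exact: form_op_onto Mn jK _ _ _ _ (ltW lam0).
  by exists S.
have [accA _] := A_m_accretive.
have [S SI SM] := accretive_resolvent accA lam0 (m_accretive_onto A_m_accretive lam0).
exists S_, S; split=> // [n|]; first by have [] := S_P n.
pose c := (1 + tan theta) ^+ 2 / 4 / lam.
have c0 : 0 < c by rewrite !divr_gt0// exprn_gt0// ltr_pwDl.
(* The perturbation estimate divided by [lam], after taking roots; s_n is positive, so it can be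
   divided by below. *)
pose s n : R := Num.sqrt (c * (eps n ^+ 2 / delta n)).
have s20 n : 0 < c * (eps n ^+ 2 / delta n) by rewrite mulr_gt0// divr_gt0// exprn_gt0.
have s0 n : 0 < s n by rewrite sqrtr_gt0.
have est n f : forall u, j u = S f ->
    (forall v, a u v + lam%:C * inner (j u) (j v) = inner f (j v)) ->
    rnorm (S_ n f - S f) <= s n * rnorm u.
  move=> u uS uE; have [w wS wE] := associated_resolvent f (A_as n) (S_P n).1.
  have := perturbation_estimate a_accretive tan0 (eps_gt0 n) (delta_gt0 n) lam0
    (B_sectorial n) (Bb n) uE wE; rewrite wS uS => H1.
  rewrite -(ler_pXn2r (_ : 0 < 2)%N) ?nnegrE ?rnorm_ge0 ?mulr_ge0 ?rnorm_ge0 ?(ltW (s0 n))//.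
  rewrite exprMn sqr_sqrtr ?(ltW (s20 n))// -(ler_pM2l lam0); apply: le_trans H1 _.
  rewrite le_eqVlt; apply/orP; left; apply/eqP; rewrite /c; field.
  by rewrite !gt_eqF.
have [K K0 SK] : exists2 K : R, 0 <= K &
    forall n f, (s n)^-1 * rnorm (S_ n f - S f) <= K * rnorm f.
  (* These individual bounds come from both resolvents being bounded by 1 / lam and blow up as s_n
     tends to 0; the principle replaces them by a uniform [K]. *)
  apply: (@uniform_boundedness _ _ _ (fun n => (s n)^-1 * (2 * lam^-1))).
  - move=> n u v; rewrite -mulrDr ler_wpM2l ?invr_ge0 ?(ltW (s0 n))//.
    by rewrite (linearD (S_ n)) (linearD S) opprD addrACA rnormD.
  - by move=> n t v; rewrite !linearZ/= -scalerDr rnormZr mulrCA.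
  - move=> n v; rewrite -mulrA ler_wpM2l ?invr_ge0 ?(ltW (s0 n))//.
    have [_ S_M] := S_P n; apply: le_trans (rnormB _ _) _.
    by have := S_M v; have := SM v; lra.
  - move=> f; have [u uS uE] := associated_resolvent f aA SI.
    (* The vector [u] solves the unperturbed equation, so the pointwise bound does not depend on
       [n]. *)
    by exists (rnorm u) => n; rewrite ler_pdivrMl// est.
apply: (@squeeze_cvgr _ _ _ _ (fun=> 0) (fun n => K * s n)).
- apply: nearW => n; apply: opnorm_le; first by rewrite mulr_ge0// ltW.
  by move=> x; have := SK n x; rewrite ler_pdivrMl// mulrCA mulrA.
- exact: cvg_cst.
- rewrite -(mulr0 K); apply: cvgMr; rewrite -(sqrtr0 R) /s.
  apply: (@cvg_comp _ _ _ (fun n => c * (eps n ^+ 2 / delta n)) Num.sqrt _ (nbhs 0)).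
    by rewrite -(mulr0 c); apply: cvgMr.
  exact: sqrt_continuous.
Qed.
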